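(* Let $\mathcal{S}$ be a PTRS that is non-overlapping, linear, and non-erasing. Then $\mathcal{S}$ is fAST if and only if $\mathcal{S}$ is wAST, and $\mathcal{S}$ is fPAST if and only if $\mathcal{S}$ is wPAST.
   Context: Terms are built over a signature $\Sigma$ and variables $\mathcal{V}$. A finite multi-distribution $\mu$ on a nonempty set $A$ is a finite multiset of pairs $(p:a)$ with $0<p\le 1$, $a\in A$, $\sum_{(p:a)\in\mu}p=1$; $\operatorname{Supp}(\mu)$ is the multiset of the $a$'s; $p\cdot\mu=\{(pq:a)\mid(q:a)\in\mu\}$. A probabilistic rewrite rule is $\ell\to\mu$ with $\ell$ a non-variable term, $\mu$ a finite multi-distribution on terms, and all variables of each $r\in\operatorname{Supp}(\mu)$ occurring in $\ell$. A PTRS is a (possibly infinite) set $\mathcal{S}$ of such rules. $s\to_{\mathcal{S}}\{p_1:t_1,\dots,p_k:t_k\}$ if there are a position $\pi$, a rule $\ell\to\{p_1:r_1,\dots,p_k:r_k\}\in\mathcal{S}$ and a substitution $\sigma$ with $s|_\pi=\ell\sigma$ and $t_j=s[r_j\sigma]_\pi$. The lifting $\rightrightarrows_{\mathcal{S}}$ is the smallest relation on finite multi-distributions of terms with: $\{1:t\}\rightrightarrows_{\mathcal{S}}\{1:t\}$ if $t$ is a normal form w.r.t. $\to_{\mathcal{S}}$; $\{1:t\}\rightrightarrows_{\mathcal{S}}\mu$ if $t\to_{\mathcal{S}}\mu$; and if $\mu_j\rightrightarrows_{\mathcal{S}}\nu_j$, $0<p_j\le1$ ($1\le j\le k$), $\sum_jp_j=1$,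 then $\bigcup_jp_j\cdot\mu_j\rightrightarrows_{\mathcal{S}}\bigcup_jp_j\cdot\nu_j$. $|\mu|_{\mathcal{S}}$ is the total probability in $\mu$ of terms that are normal forms w.r.t. $\mathcal{S}$. For an infinite $\rightrightarrows_{\mathcal{S}}$-sequence $\vec\mu=(\mu_n)_n$, $\operatorname{edl}(\vec\mu)=\sum_{n=0}^\infty(1-|\mu_n|_{\mathcal{S}})$. $\mathcal{S}$ is fAST if every infinite $\rightrightarrows_{\mathcal{S}}$-sequence satisfies $\lim_n|\mu_n|_{\mathcal{S}}=1$, and fPAST if every such sequence has finite $\operatorname{edl}$. $\mathcal{S}$ is wAST (resp. wPAST) if for every term $t$ there exists an infinite $\rightrightarrows_{\mathcal{S}}$-sequence $(\mu_n)_n$ with $\mu_0=\{1:t\}$ and $\lim_n|\mu_n|_{\mathcal{S}}=1$ (resp. with finite $\operatorname{edl}$). Two rules (variables renamed apart) overlap if some non-variable subterm $\ell_1|_\pi$ of one left-hand side unifies with the other left-hand side $\ell_2$ (with $\pi\ne\varepsilon$ if it is the same rule); $\mathcal{S}$ is non-overlapping if no rules overlap. $\mathcal{S}$ is linear if no variable occurs more than once in any left-hand side and no variable occurs more than once in any $r\in\operatorname{Supp}(\mu)$ of a rule $\ell\to\mu$. $\mathcal{S}$ is non-erasing if for every rule $\ell\to\mu$ and every $r\in\operatorname{Supp}(\mu)$, every variable of $\ell$ occurs in $r$. *)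

(* Defs.v *)
From HB Require Import structures.
From mathcomp Require Import all_boot all_order all_algebra.
From mathcomp Require Import finmap multiset.
From mathcomp Require Import all_classical all_reals all_analysis.
Import Order.TTheory GRing.Theory Num.Theory.
Import numFieldNormedType.Exports.

Set Implicit Arguments.
Unset Strict Implicit.
Unset Printing Implicit Defensive.

Local Open Scope ring_scope.
Local Open Scope classical_set_scope.
Local Open Scope mset_scope.

Record signature := Signature { symbol :> Type; arity : symbol -> nat }.

Inductive term (Sg : signature) (V : Type) : Type :=
| Var of V
| App (f : Sg) of ('I_(arity f) -> term Sg V).

Arguments Var {Sg V} _.
Arguments App {Sg V} f _.

(* Classical equality and choice on terms, required by {mset _}. *)
HB.instance Definition _ (Sg : signature) (V : Type) :=
  gen_eqMixin (term Sg V).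
HB.instance Definition _ (Sg : signature) (V : Type) :=
  gen_choiceMixin (term Sg V).

Section Terms.
Variable Sg : signature.

Definition is_var (V : Type) (t : term Sg V) : bool :=
  if t is Var _ then true else false.

Fixpoint subst (V W : Type) (s : V -> term Sg W) (t : term Sg V) : term Sg W :=
  match t with
  | Var x => s x
  | App f ts => App f (fun i => subst s (ts i))
  end.

Definition rename (V W : Type) (h : V -> W) : term Sg V -> term Sg W :=
  subst (fun x => Var (h x)).

Definition unifiable (V : Type) (s t : term Sg V) : Prop :=
  exists sigma : V -> term Sg V, subst sigma s = subst sigma t.

(* Positions are sequences of argument indices counted from 0; the result is
   None when the position does not exist in the term. *)
Fixpoint subterm_at (V : Type) (t : term Sg V) (pi : seq nat) :
    option (term Sg V) :=
  match pi, t with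
  | [::], _ => Some t
  | i :: pi', App f ts =>
      if insub i is Some j then subterm_at (ts j) pi' else None
  | _ :: _, Var _ => None
  end.

Fixpoint replace_at (V : Type) (t : term Sg V) (pi : seq nat)
    (u : term Sg V) : term Sg V :=
  match pi, t with
  | [::], _ => u
  | i :: pi', App f ts =>
      App f (fun j => if val j == i then replace_at (ts j) pi' u else ts j)
  | _ :: _, Var _ => t
  end.

Fixpoint nocc (V : eqType) (x : V) (t : term Sg V) : nat :=
  match t with
  | Var y => (x == y)%N
  | App f ts => (\sum_(i < arity f) nocc x (ts i))%N
  end.

Definition occurs (V : eqType) (x : V) (t : term Sg V) : Prop :=
  (0 < nocc x t)%N.

End Terms.

Definition mset_map (A B : choiceType) (f : A -> B) (mu : {mset A}) :
    {mset B} :=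
  seq_mset [seq f x | x <- mu].

Section MultiDistributions.
Context {R : realType} {A : choiceType}.

Definition is_mdist (mu : {mset (R * A)%type}) : Prop :=
  (forall x, x \in mu -> 0 < x.1 <= 1) /\ \sum_(x <- mu) x.1 = 1.

Definition in_supp (a : A) (mu : {mset (R * A)%type}) : Prop :=
  exists p : R, (p, a) \in mu.

Definition mdist_scale (p : R) (mu : {mset (R * A)%type}) : {mset (R * A)%type} :=
  mset_map (fun x => (p * x.1, x.2)) mu.

Definition mdist_unit (a : A) : {mset (R * A)%type} := [mset ((1, a) : R * A)].

End MultiDistributions.

Section PTRS.
Variables (R : realType) (Sg : signature) (V : eqType).

Local Notation tmset := {mset (R * term Sg V)%type}.

Record rule := Rule { lhs : term Sg V; rhs : tmset }.

Definition is_prule (rl : rule) : Prop :=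
  [/\ ~~ is_var (lhs rl),
      is_mdist (rhs rl) &
      forall r, in_supp r (rhs rl) -> forall x, occurs x r -> occurs x (lhs rl)].

Record ptrs := Ptrs {
  rules :> set rule;
  rulesP : forall rl, rules rl -> is_prule rl }.

Variable S : ptrs.

Definition step (s : term Sg V) (mu : tmset) : Prop :=
  exists (pi : seq nat) (rl : rule) (sigma : V -> term Sg V),
    [/\ rules S rl,
        subterm_at s pi = Some (subst sigma (lhs rl)) &
        mu = mset_map (fun x => (x.1, replace_at s pi (subst sigma x.2)))
                      (rhs rl)].

Definition normal_form (t : term Sg V) : Prop := ~ exists mu, step t mu.

(* Only multi-distributions are related, see lifting_mdist; the union of
   multisets is additive. *)
Inductive lifting : tmset -> tmset -> Prop :=
| lifting_nf t : normal_form t -> lifting (mdist_unit t) (mdist_unit t)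
| lifting_step t mu : step t mu -> lifting (mdist_unit t) mu
| lifting_conv (k : nat) (p : 'I_k -> R) (mu nu : 'I_k -> tmset) :
    (forall j, lifting (mu j) (nu j)) ->
    (forall j, 0 < p j <= 1) ->
    \sum_(j < k) p j = 1 ->
    lifting (\big[msetD/mset0]_(j < k) mdist_scale (p j) (mu j))
            (\big[msetD/mset0]_(j < k) mdist_scale (p j) (nu j)).

Definition nf_mass (mu : tmset) : R :=
  \sum_(x <- mu | `[< normal_form x.2 >]) x.1.

Definition lifting_sequence (mu : nat -> tmset) : Prop :=
  forall n, lifting (mu n) (mu n.+1).

Definition almost_surely_terminating (mu : nat -> tmset) : Prop :=
  (fun n => nf_mass (mu n)) @ \oo --> (1 : R).

Definition edl (mu : nat -> tmset) : \bar R :=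
  (\sum_(0 <= n <oo) (1 - nf_mass (mu n))%:E)%E.

Definition fAST : Prop :=
  forall mu, lifting_sequence mu -> almost_surely_terminating mu.

Definition fPAST : Prop :=
  forall mu, lifting_sequence mu -> edl mu \is a fin_num.

Definition wAST : Prop :=
  forall t : term Sg V, exists mu,
    [/\ lifting_sequence mu, mu 0%N = mdist_unit t &
        almost_surely_terminating mu].

Definition wPAST : Prop :=
  forall t : term Sg V, exists mu,
    [/\ lifting_sequence mu, mu 0%N = mdist_unit t & edl mu \is a fin_num].

(* The two rules are renamed apart into the disjoint union V + V. *)
Definition overlap (rl1 rl2 : rule) : Prop :=
  exists (pi : seq nat) (u : term Sg V),
    [/\ subterm_at (lhs rl1) pi = Some u,
        ~~ is_var u,
        rl1 = rl2 -> pi <> [::] &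
        unifiable (rename (@inl V V) u) (rename (@inr V V) (lhs rl2))].

Definition non_overlapping : Prop :=
  forall rl1 rl2, rules S rl1 -> rules S rl2 -> ~ overlap rl1 rl2.

Definition linear_term (t : term Sg V) : Prop :=
  forall x : V, (nocc x t <= 1)%N.

Definition linear_ptrs : Prop :=
  forall rl, rules S rl ->
    linear_term (lhs rl) /\ forall r, in_supp r (rhs rl) -> linear_term r.

Definition non_erasing : Prop :=
  forall rl, rules S rl -> forall r, in_supp r (rhs rl) ->
    forall x, occurs x (lhs rl) -> occurs x r.

End PTRS.

Arguments mdist_unit {R A} a.

Lemma mem_mset_map (A B : choiceType) (f : A -> B) (mu : {mset A}) y :
  y \in mset_map f mu -> exists2 x, x \in mu & y = f x.
Proof.
move=> H; have /mapP[x xmu ->] : y \in [seq f x | x <- mu].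
  by rewrite -(perm_mem (perm_eq_seq_mset _)).
by exists x.
Qed.

Lemma big_mset_map (R : realType) (A B : choiceType) (f : A -> B)
    (mu : {mset A}) (F : B -> R) :
  \sum_(y <- mset_map f mu) F y = \sum_(x <- mu) F (f x).
Proof. by rewrite (perm_big _ (perm_eq_seq_mset _)) big_map. Qed.

Lemma perm_enum_msetD (A : choiceType) (mu nu : {mset A}) :
  perm_eq (mu `+` nu)%mset (mu ++ nu).
Proof. by apply/allP => x _ /=; rewrite count_cat !count_mem_mset msetE2. Qed.

Lemma mdist_unit_mdist (R : realType) (A : choiceType) (a : A) :
  is_mdist (mdist_unit a : {mset (R * A)%type}).
Proof.
split=> [x|]; last by rewrite /mdist_unit enum_msetn big_seq1.
by rewrite in_msetn => /eqP -> /=; rewrite ltr01 lexx.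
Qed.

Lemma conv_mdist (R : realType) (A : choiceType) (k : nat) (p : 'I_k -> R)
    (mu : 'I_k -> {mset (R * A)%type}) :
  (forall j, is_mdist (mu j)) -> (forall j, 0 < p j <= 1) ->
  \sum_(j < k) p j = 1 ->
  is_mdist (\big[msetD/mset0]_(j < k) mdist_scale (p j) (mu j)).
Proof.
move=> muP p01 p1; split=> [x|].
  elim/big_rec: _ => [|j y _ IH]; first by rewrite in_mset0.
  rewrite in_msetD => /orP[/mem_mset_map[z zmu ->] /=|//].
  have [/(_ _ zmu)/andP[z0 z1] _] := muP j.
  have /andP[q0 q1] := p01 j.
  by rewrite mulr_gt0 //= mulr_ile1 // ltW.
transitivity (\sum_(j < k) \sum_(x <- mdist_scale (p j) (mu j)) x.1).
  apply: (big_rec2 (fun (m : {mset (R * A)%type}) s => \sum_(x <- m) x.1 = s)).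
    by rewrite enum_mset0 big_nil.
  move=> j m s _ <-.
  by rewrite (perm_big _ (perm_enum_msetD _ _)) big_cat.
rewrite -[RHS]p1; apply: eq_bigr => j _.
by rewrite big_mset_map /= -mulr_sumr (muP j).2 mulr1.
Qed.

Lemma lifting_mdist (R : realType) (Sg : signature) (V : eqType)
    (S : ptrs R Sg V) mu nu :
  lifting S mu nu -> is_mdist mu /\ is_mdist nu.
Proof.
elim=> [t _|t {}mu [pi [rl [sigma [Srl _ ->]]]]|k p {}mu {}nu _ IH p01 p1].
- by split; exact: mdist_unit_mdist.
- split; first exact: mdist_unit_mdist.
  have [_ [r01 r1] _] := rulesP Srl.
  split=> [x /mem_mset_map[y /r01 ? ->] //|].
  by rewrite big_mset_map.
- by split; apply: conv_mdist => // j; case: (IH j).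
Qed.

(* Main.v *)
(** Linearity and non-erasure make a redex below a matched variable survive
    exactly once in every outcome of the outer step, so two different one-step
    reductions of a term can each be continued by exactly one further step in
    every outcome to a common multi-distribution.  By induction on [n], the
    normal-form mass after [n] steps does therefore not depend on the strategy:
    it is the expectation over the initial multi-distribution of a function
    [nf_prob n] of terms.  Both termination notions are then determined by
    their behaviour on single starting terms. *)
Require Import Defs.
From mathcomp Require Import all_boot all_order all_algebra.
From mathcomp Require Import finmap multiset.
From mathcomp Require Import all_classical all_reals all_analysis.
From Stdlib Require Eqdep_dec.
Import Order.TTheory GRing.Theory Num.Theory.
Import numFieldNormedType.Exports.

Set Implicit Arguments.
Unset Strict Implicit.
Unset Printing Implicit Defensive.

Local Open Scope ring_scope.
Local Open Scope classical_set_scope.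
Local Open Scope mset_scope.

(** * Pointwise update of argument tuples and substitutions *)

Definition upd (I : eqType) (T : Type) (a : I -> T) (i : I) (u : T) : I -> T :=
  fun j => if j == i then u else a j.

Lemma upd_eq (I : eqType) (T : Type) (a : I -> T) i u : upd a i u i = u.
Proof. by rewrite /upd eqxx. Qed.

Lemma upd_neq (I : eqType) (T : Type) (a : I -> T) i u j :
  j != i -> upd a i u j = a j.
Proof. by rewrite /upd => /negbTE ->. Qed.

Lemma upd_upd (I : eqType) (T : Type) (a : I -> T) i u v :
  upd (upd a i u) i v = upd a i v.
Proof. by apply/funext => j; rewrite /upd; case: eqP. Qed.

Lemma updC (I : eqType) (T : Type) (a : I -> T) i j u v :
  i != j -> upd (upd a i u) j v = upd (upd a j v) i u.
Proof.
move=> ij; apply/funext => k; rewrite /upd.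
by case: (eqVneq k j) => // ->; rewrite eq_sym (negbTE ij).
Qed.

(** * Substitution and linear terms *)

Section Terms.
Variable Sg : signature.

(** Constructor injectivity yields only an equality of dependent pairs over [f]; classically
    decidable equality of symbols removes the dependency. *)
Lemma App_inj (V : Type) (f : Sg) (ts us : 'I_(arity f) -> term Sg V) :
  App f ts = App f us -> ts = us.
Proof.
case=> H; apply: (Eqdep_dec.inj_pair2_eq_dec _ _ _ _ _ _ H) => a b.
by case: (pselect (a = b)); [left|right].
Qed.

Lemma subst_comp (V W X : Type) (s : V -> term Sg W) (h : W -> term Sg X) t :
  subst h (subst s t) = subst (subst h \o s) t.
Proof. by elim: t => //= f ts IH; congr App; apply/funext. Qed.

Lemma occurs_arg (V : eqType) (x : V) (f : Sg)
    (ts : 'I_(arity f) -> term Sg V) i :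
  occurs x (ts i) -> occurs x (App f ts).
Proof.
by rewrite /occurs /= (bigD1 i) //= => H; apply: leq_trans H (leq_addr _ _).
Qed.

Lemma linear_arg (V : eqType) (f : Sg) (ts : 'I_(arity f) -> term Sg V) i :
  linear_term (App f ts) -> linear_term (ts i).
Proof.
move=> lin x; apply: leq_trans (lin x).
by rewrite /= (bigD1 i) //= leq_addr.
Qed.

Lemma linear_arg_eq (V : eqType) (x : V) (f : Sg)
    (ts : 'I_(arity f) -> term Sg V) i j :
  linear_term (App f ts) -> occurs x (ts i) -> j != i -> ~ occurs x (ts j).
Proof.
move=> /(_ x) /=; rewrite /occurs => lin xi ji xj.
move: lin; rewrite (bigD1 i) //= (bigD1 j) //= leqNgt => /negP; apply.
exact: leq_add xi (leq_trans xj (leq_addr _ _)).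
Qed.

Lemma eq_subst (V : eqType) (W : Type) (s s' : V -> term Sg W) t :
  (forall x, occurs x t -> s x = s' x) -> subst s t = subst s' t.
Proof.
elim: t => [x|f ts IH] /= H; first by apply: H; rewrite /occurs /= eqxx.
congr App; apply/funext => i; apply: IH => x xi; apply: H.
exact: occurs_arg xi.
Qed.

Lemma subst_inj (V : eqType) (W : Type) (s s' : V -> term Sg W) t :
  subst s t = subst s' t -> forall x, occurs x t -> s x = s' x.
Proof.
elim: t => [y|f ts IH] /=.
  by move=> H x; rewrite /occurs /=; case: eqP => // ->.
move=> /App_inj /(congr1 (fun a => a _)) H x.
rewrite /occurs /= lt0n sum_nat_eq0 => /forallPn[i]; rewrite negb_imply /=.
by rewrite -lt0n => xi; apply: (IH i) xi; exact: H.
Qed.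

(** By linearity [x] occurs in no other argument, so [s] and [upd s x v] agree there. *)
Lemma subst_upd_arg (V : eqType) (s : V -> term Sg V) (x : V) v (f : Sg)
    (ts : 'I_(arity f) -> term Sg V) i :
  linear_term (App f ts) -> occurs x (ts i) ->
  upd (fun j => subst s (ts j)) i (subst (upd s x v) (ts i)) =
  fun j => subst (upd s x v) (ts j).
Proof.
move=> lin xi; apply/funext => j; rewrite {1}/upd.
case: eqVneq => [-> //|ji]; apply: eq_subst => y yj; rewrite upd_neq //.
by apply/eqP => yx; apply: (linear_arg_eq lin xi ji); rewrite -yx.
Qed.

End Terms.

(** * Finite expectations *)

Definition expect (R : realType) (T : Type) (m : seq (R * T)) (G : T -> R) : R :=
  \sum_(x <- m) x.1 * G x.2.

Lemma expect_map (R : realType) (T U : Type) (h : T -> U) (m : seq (R * T)) G :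
  expect [seq (x.1, h x.2) | x <- m] G = expect m (G \o h).
Proof. by rewrite /expect big_map. Qed.

Lemma expectC (R : realType) (T U : Type) (m : seq (R * T)) (m' : seq (R * U))
    (G : T -> U -> R) :
  expect m (fun x => expect m' (G x)) =
  expect m' (fun y => expect m (fun x => G x y)).
Proof.
rewrite /expect.
under eq_bigr do rewrite mulr_sumr.
rewrite exchange_big /=; apply: eq_bigr => y _.
by rewrite mulr_sumr; apply: eq_bigr => x _; rewrite mulrCA.
Qed.

(** * One-step reductions *)

Section Rewriting.
Variables (R : realType) (Sg : signature) (V : eqType) (S : ptrs R Sg V).

Local Notation tm := (term Sg V).

(* [step] with positions replaced by structural recursion and multisets by
   sequences. *)
Inductive red : tm -> seq (R * tm) -> Prop :=
| red_root rl s : rules S rl ->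
    red (subst s (lhs rl)) [seq (x.1, subst s x.2) | x <- rhs rl]
| red_arg f ts i m : red (ts i) m ->
    red (App f ts) [seq (x.1, App f (upd ts i x.2)) | x <- m].

Lemma red_inv t m : red t m ->
  (exists rl s, [/\ rules S rl, t = subst s (lhs rl) &
     m = [seq (x.1, subst s x.2) | x <- rhs rl]]) \/
  (exists f ts i m', [/\ t = App f ts, red (ts i) m' &
     m = [seq (x.1, App f (upd ts i x.2)) | x <- m']]).
Proof.
case=> [rl s Srl|f ts i m' tm']; first by left; exists rl, s.
by right; exists f, ts, i, m'.
Qed.

Lemma red_App f ts m : red (App f ts) m ->
  (exists rl s, [/\ rules S rl, App f ts = subst s (lhs rl) &
     m = [seq (x.1, subst s x.2) | x <- rhs rl]]) \/
  (exists i m', red (ts i) m' /\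
     m = [seq (x.1, App f (upd ts i x.2)) | x <- m']).
Proof.
case/red_inv=> [|[g [us [i [m' [e r ->]]]]]]; first by left.
have fg : f = g by case: e.
by case: g / fg us i e r => us i /App_inj -> r; right; exists i, m'.
Qed.

Lemma step_red t mu : step S t mu -> exists2 m, red t m & mu = seq_mset m.
Proof.
move=> [pi [rl [s [Srl]]]] => tpi ->.
exists [seq (x.1, replace_at t pi (subst s x.2)) | x <- rhs rl] => //.
elim: pi t tpi => [|i pi IH] t /=.
  by case: t => [y|f ts] /= [->]; exact: red_root.
case: t => [//|f ts] /=; case: insubP => [j _ ji|//] /IH tj.
have := red_arg (ts := ts) tj; rewrite -map_comp; congr red; apply: eq_map => x /=.
congr (_, App f _); apply/funext => k; rewrite /upd -val_eqE ji.
by case: eqP => //; rewrite -ji => /val_inj ->.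
Qed.

Lemma red_step t m : red t m -> step S t (seq_mset m).
Proof.
move=> tm'; suff [pi [rl [s [Srl tpi ->]]]] : exists pi rl s,
    [/\ rules S rl, subterm_at t pi = Some (subst s (lhs rl)) &
     m = [seq (x.1, replace_at t pi (subst s x.2)) | x <- rhs rl]].
  by exists pi, rl, s.
elim: tm' => [rl s Srl|f ts i m' _ [pi [rl [s [Srl tpi ->]]]]].
  by exists [::], rl, s; split => //; case: (subst s _).
exists (val i :: pi), rl, s; split => //=.
  by rewrite insubT //= => iP; rewrite (_ : Sub _ _ = i) //; exact: val_inj.
rewrite -map_comp; apply: eq_map => x /=; congr (_, App f _); apply/funext => k.
by rewrite /upd -val_eqE; case: eqVneq => // /val_inj ->.
Qed.

Lemma normal_formP t : normal_form S t <-> ~ exists m, red t m.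
Proof.
split=> nf [m tm']; apply: nf; first by exists (seq_mset m); exact: red_step.
by have [m' ? _] := step_red tm'; exists m'.
Qed.

Lemma expect_mset (m : seq (R * tm)) G : expect (seq_mset m) G = expect m G.
Proof. exact: perm_big (perm_eq_seq_mset _). Qed.

(** As [x] occurs exactly once in [r], there is a single copy of [s x], and contracting it amounts
    to updating [s] at [x]. *)
Lemma red_subst (s : V -> tm) x r m : linear_term r -> occurs x r -> red (s x) m ->
  red (subst s r) [seq (y.1, subst (upd s x y.2) r) | y <- m].
Proof.
elim: r => [y|f rs IH] lin.
  rewrite /occurs /=; case: eqP => // <- _.
  by under eq_map do rewrite upd_eq -surjective_pairing; rewrite map_id.
move=> xr sx; move: (xr).
rewrite {1}/occurs /= lt0n sum_nat_eq0 => /forallPn[i]; rewrite negb_imply /=.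
rewrite -lt0n => xi.
have /(@red_arg _ (fun j => subst s (rs j))) := IH i (linear_arg i lin) xi sx.
rewrite -map_comp; congr red; apply: eq_map => y /=.
by rewrite subst_upd_arg.
Qed.

(** * Two redexes in one term *)

Hypothesis NO : non_overlapping S.
Hypothesis LIN : linear_ptrs S.
Hypothesis NE : non_erasing S.

Lemma no_unifier rl1 rl2 pi u (s1 s2 : V -> tm) :
  rules S rl1 -> rules S rl2 -> subterm_at (lhs rl1) pi = Some u ->
  ~~ is_var u -> (rl1 = rl2 -> pi <> [::]) ->
  subst s1 u <> subst s2 (lhs rl2).
Proof.
move=> S1 S2 upi uV rlpi e; apply: (NO S1 S2); exists pi, u; split=> //.
(* Gluing [s1] and [s2] along the two summands of [V + V] gives the unifier; [rename inl] only moves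
   the images to terms over [V + V]. *)
exists (fun z => rename inl (match z with inl x => s1 x | inr x => s2 x end)).
by rewrite /rename !subst_comp /comp /= -[LHS]subst_comp -[RHS]subst_comp e.
Qed.

(** No redex starts at a non-variable position of [u], so the contracted one lies inside [s x] for a
    variable [x] of [u]; since [u] is linear, contracting it is an update of [s] at [x]. *)
Lemma red_below (s : V -> tm) u m : linear_term u ->
  (forall pi v rl s', subterm_at u pi = Some v -> ~~ is_var v -> rules S rl ->
     subst s v <> subst s' (lhs rl)) ->
  red (subst s u) m ->
  exists x m', [/\ occurs x u, red (s x) m' &
    m = [seq (y.1, subst (upd s x y.2) u) | y <- m']].
Proof.
elim: u m => [x|f us IH] m lin noroot.
  move=> sx; exists x, m; split=> //; first by rewrite /occurs /= eqxx.
  by under eq_map do rewrite /= upd_eq -surjective_pairing; rewrite map_id.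
case/red_App => [[rl [s' [Srl e _]]]|[i [m1 [m1P ->]]]].
  by case: (noroot [::] (App f us) rl s').
have [|x [m' [xi m'P ->]]] := IH i m1 (linear_arg i lin) _ m1P.
  move=> pi v rl s' vpi; apply: (noroot (val i :: pi)).
  by rewrite /= insubT //= => iP; rewrite (_ : Sub _ _ = i) //; exact: val_inj.
exists x, m'; split=> //; first exact: occurs_arg xi.
rewrite -map_comp; apply: eq_map => y /=.
by rewrite subst_upd_arg.
Qed.

(** In the application [K] is [nf_prob n] and [H] is the same with one step less, or zero when [n]
    is 0. Values of [K] at normal forms are unconstrained. *)
Definition one_step_mean (K H : tm -> R) :=
  forall t m, red t m -> K t = expect m H.

(** Distinct rules would overlap at the root. For a single rule, [s1] and [s2] agree on the
    variables of the left-hand side, hence on those of every right-hand side. *)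
Lemma root_root_mean rl1 rl2 (s1 s2 : V -> tm) G :
  rules S rl1 -> rules S rl2 -> subst s1 (lhs rl1) = subst s2 (lhs rl2) ->
  expect [seq (x.1, subst s1 x.2) | x <- rhs rl1] G =
  expect [seq (x.1, subst s2 x.2) | x <- rhs rl2] G.
Proof.
move=> S1 S2 e; case: (pselect (rl1 = rl2)) => [erl|nrl]; last first.
  have [lV _ _] := rulesP S1.
  by case: (@no_unifier rl1 rl2 [::] (lhs rl1) s1 s2 S1 S2) => //; case: (lhs rl1).
rewrite -erl in e *; rewrite !expect_map /expect; apply: eq_big_seq => x xr /=.
congr (_ * G _); apply: eq_subst => y yx; apply: (subst_inj e).
have [_ _ occ] := rulesP S1; apply: occ yx.
by exists x.1; rewrite -surjective_pairing.
Qed.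

(** The inner redex lies in [s x] for a variable [x] of the left-hand side. Every outcome [r] of the
    root step contains [x] exactly once, and after the inner step the root rule still matches with
    [s] updated at [x]. Both orders thus give the double mean of [H (subst (upd s x v) r)]. *)
Lemma root_arg_mean K H rl (s : V -> tm) f ts i m : one_step_mean K H -> rules S rl ->
  App f ts = subst s (lhs rl) -> red (ts i) m ->
  expect [seq (x.1, subst s x.2) | x <- rhs rl] K =
  expect [seq (x.1, App f (upd ts i x.2)) | x <- m] K.
Proof.
move=> KH Srl e tm'.
have [lV _ _] := rulesP Srl.
have [linl linr] := LIN Srl.
case el : (lhs rl) lV => [//|g ls] _.
have fg : f = g by move: e; rewrite el => -[].
case: g / fg ls el => ls el.
have ets : ts = fun j => subst s (ls j) by apply: App_inj; rewrite e el.
rewrite {}ets {e} in tm' *.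
have linls : linear_term (App f ls) by rewrite -el.
have [|x [m' [xi m'P ->]]] := red_below (linear_arg i linls) _ tm'.
  move=> pi v rl2 s' vpi vV S2; apply: (@no_unifier rl rl2 (val i :: pi)) => //.
  rewrite el /= insubT //= => iP.
  by rewrite (_ : Sub _ _ = i) //; exact: val_inj.
rewrite -map_comp /=.
under [in RHS]eq_map do rewrite /= subst_upd_arg //.
rewrite expect_map.
transitivity (expect (rhs rl) (fun r =>
    expect m' (fun v => H (subst (upd s x v) r)))).
  apply: eq_big_seq => r rr /=; congr (_ * _).
  have rsupp : in_supp r.2 (rhs rl) by exists r.1; rewrite -surjective_pairing.
  have xr : occurs x r.2.
    by apply: (NE Srl rsupp); rewrite el; exact: occurs_arg xi.
  by rewrite (KH _ _ (red_subst (linr _ rsupp) xr m'P))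
    (expect_map (fun v => subst (upd s x v) r.2)).
rewrite expectC.
rewrite (expect_map (fun v => App f (fun j => subst (upd s x v) (ls j)))).
apply: eq_bigr => v _; congr (_ * _) => /=.
by have := red_root (upd s x v.2) Srl; rewrite el => /KH /= ->;
  rewrite expect_map.
Qed.

(* For different redexes, each outcome of one step still contains the other
   redex exactly once; contracting it next turns both sides into iterated
   expectations of [H] that differ by the order of summation. *)
Lemma red_mean_unique K H t m1 m2 : one_step_mean K H ->
  red t m1 -> red t m2 -> expect m1 K = expect m2 K.
Proof.
elim: t K H m1 m2 => [x|f ts IH] K H m1 m2 KH.
  have nored m : ~ red (Var x) m.
    case/red_inv => [[rl [s [Srl e _]]]|[g [us [i [m' []]]]] //].
    by have [] := rulesP Srl; case: (lhs rl) e.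
  by move=> /nored.
move=> /red_App[[rl1 [s1 [S1 e1 ->]]]|[i [m1' [r1 ->]]]]
  /red_App[[rl2 [s2 [S2 e2 ->]]]|[j [m2' [r2 ->]]]].
- by apply: root_root_mean; rewrite // -e1.
- exact: (root_arg_mean KH S1 e1 r2).
- by symmetry; exact: (root_arg_mean KH S2 e2 r1).
have [ij|ij] := eqVneq i j.
  rewrite -{}ij in r2 *; rewrite !(expect_map (fun u => App f (upd ts i u))).
  (* The context around argument [i] is absorbed into [K] and [H], hence the induction over all such
     pairs. *)
  apply: (IH i _ (fun u => H (App f (upd ts i u)))) => // t m tm'.
  have := @red_arg f (upd ts i t) i m; rewrite upd_eq => /(_ tm') /KH /= ->.
  rewrite (expect_map (fun u => App f (upd (upd ts i t) i u))).
  by apply: eq_bigr => x _; rewrite /= upd_upd.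
rewrite (expect_map (fun u => App f (upd ts i u))).
rewrite (expect_map (fun u => App f (upd ts j u))).
transitivity (expect m1' (fun u => expect m2' (fun v =>
    H (App f (upd (upd ts i u) j v))))).
  apply: eq_bigr => x _; congr (_ * _) => /=.
  have := @red_arg f (upd ts i x.2) j m2'.
  rewrite upd_neq 1?eq_sym // => /(_ r2) /KH ->.
  by rewrite (expect_map (fun v => App f (upd (upd ts i x.2) j v))).
rewrite expectC; apply: eq_bigr => x _; congr (_ * _) => /=.
have := @red_arg f (upd ts j x.2) i m1'.
rewrite upd_neq // => /(_ r1) /KH ->.
rewrite (expect_map (fun v => App f (upd (upd ts j x.2) i v))).
by apply: eq_bigr => y _; rewrite /= updC.
Qed.

(** * Normal-form mass after a number of steps *)

Fixpoint nf_prob (n : nat) (t : tm) : R :=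
  match pselect (exists m, red t m) with
  | left ex => if n is n'.+1 then expect (projT1 (cid ex)) (nf_prob n') else 0
  | right _ => 1
  end.

Lemma nf_prob_nf n t : normal_form S t -> nf_prob n t = 1.
Proof. by move=> /normal_formP; case: n => [|n] /=; case: pselect. Qed.

Lemma nf_prob0_red t m : red t m -> nf_prob 0 t = 0.
Proof. by move=> tm'; rewrite /=; case: pselect => // -[]; exists m. Qed.

(** [nf_prob] follows a reduction picked by [cid]. By [red_mean_unique] any other gives the same
    mean, provided [nf_prob n] is itself a one-step mean; this is shown by induction on [n]. *)
Lemma nf_prob_red n t m : red t m -> nf_prob n.+1 t = expect m (nf_prob n).
Proof.
suff [H KH] : exists H, one_step_mean (nf_prob n) H.
  move=> tm' /=; case: pselect => [ex|[]]; last by exists m.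
  by case: (cid ex) => m' /= tm''; exact: (red_mean_unique KH tm'' tm').
elim: n {t m} => [|n [H KH]].
  (* With no step left, [nf_prob 0] vanishes on reducible terms, so [H] can be zero. *)
  exists (fun=> 0) => t m /nf_prob0_red ->.
  by rewrite /expect big1 // => x _; rewrite mulr0.
exists (nf_prob n) => t m tm' /=; case: pselect => [ex|[]]; last by exists m.
by case: (cid ex) => m' /= tm''; exact: (red_mean_unique KH tm'' tm').
Qed.

Lemma expect_scale p (mu : {mset (R * tm)%type}) G :
  expect (mdist_scale p mu) G = p * expect mu G.
Proof.
rewrite /expect big_mset_map mulr_sumr.
by apply: eq_bigr => x _; rewrite /= mulrA.
Qed.

Lemma expect_conv k (p : 'I_k -> R) (mu : 'I_k -> {mset (R * tm)%type}) G :
  expect (\big[msetD/mset0]_(j < k) mdist_scale (p j) (mu j)) G =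
  \sum_(j < k) p j * expect (mu j) G.
Proof.
apply: (big_rec2 (fun (m : {mset (R * tm)%type}) a => expect m G = a)).
  by rewrite /expect enum_mset0 big_nil.
move=> j a m _ <-; rewrite -expect_scale /expect.
by rewrite (perm_big _ (perm_enum_msetD _ _)) big_cat.
Qed.

Lemma expect_unit t G : expect (mdist_unit t : {mset (R * tm)%type}) G = G t.
Proof. by rewrite /expect /mdist_unit enum_msetn big_seq1 mul1r. Qed.

(** A lifting step contracts one redex in each reducible term and keeps normal forms, where
    [nf_prob] is 1 at every index; linearity of means settles convex combinations. *)
Lemma lifting_nf_prob n mu nu : lifting S mu nu ->
  expect nu (nf_prob n) = expect mu (nf_prob n.+1).
Proof.
elim=> [t nf|t {}mu /step_red[m tm' ->]|k p {}mu {}nu _ IH _ _].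
- by rewrite !expect_unit !nf_prob_nf.
- by rewrite expect_mset expect_unit (nf_prob_red _ tm').
- by rewrite !expect_conv; apply: eq_bigr => j _; rewrite IH.
Qed.

(** [nf_prob 0] is the indicator of the normal forms. *)
Lemma nf_massE mu : nf_mass S mu = expect mu (nf_prob 0).
Proof.
rewrite /nf_mass big_mkcond; apply: eq_bigr => x _.
case: asboolP => [/nf_prob_nf ->|nnf]; first by rewrite mulr1.
have [m tm'] : exists m, red x.2 m.
  by apply: contrapT => /normal_formP.
by rewrite (nf_prob0_red tm') mulr0.
Qed.

Lemma nf_mass_sequence mu : lifting_sequence S mu ->
  forall n, nf_mass S (mu n) = expect (mu 0%N) (nf_prob n).
Proof.
(* Generalised to a start at index [k]: [nf_mass S (mu (n + k))] is the mean of [nf_prob n] over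
   [mu k]. *)
move=> muS n; rewrite -[in LHS](addn0 n); elim: n 0%N => [|n IH] k.
  exact: nf_massE.
by rewrite addSnnS IH; exact: lifting_nf_prob.
Qed.

(** Serves to make the terms [1 - nf_prob n t] of the [edl] series nonnegative. *)
Lemma nf_prob_le1 n t : nf_prob n t <= 1.
Proof.
elim: n t => [|n IH] t; case: (pselect (exists m, red t m)) => [[m tm']|nf];
  try by rewrite nf_prob_nf //; exact/normal_formP.
  by rewrite (nf_prob0_red tm').
rewrite (nf_prob_red _ tm') -expect_mset.
have [_ [m01 <-]] := lifting_mdist (lifting_step (red_step tm')).
rewrite /expect big_seq [leRHS]big_seq; apply: ler_sum => x /m01/andP[x0 _].
by rewrite ler_piMr ?IH ?ltW.
Qed.

(** * Existence of infinite lifting sequences *)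

Lemma lifting_unit_ex t : exists nu, lifting S (mdist_unit t) nu.
Proof.
case: (pselect (normal_form S t)) => [nf|/contrapT[nu tnu]].
  by exists (mdist_unit t); exact: lifting_nf.
by exists nu; exact: lifting_step.
Qed.

Lemma mset_big1 (K : choiceType) (mu : {mset K}) :
  mu = \big[msetD/mset0]_(x <- mu) [mset x].
Proof.
rewrite -[LHS]seq_mset_id; elim: (enum_mset mu) => [|a s IH].
  by rewrite big_nil; apply/msetP => b; rewrite mset_seqE mset0E.
rewrite big_cons -IH; apply/msetP => b.
by rewrite mset_seqE /= msetE2 mset_seqE msetnE eq_sym; case: eqP.
Qed.

Lemma mdist_scale_unit (p : R) (t : tm) : mdist_scale p (mdist_unit t) = [mset (p, t)].
Proof.
apply/msetP => b; rewrite /mdist_scale /mset_map mset_seqE enum_msetn /=.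
by rewrite mulr1 addn0 msetnE eq_sym; case: eqP.
Qed.

(** [mu] is the convex combination of its point distributions, weighted by its own probabilities,
    and each of these has a lift. *)
Lemma lifting_ex mu : is_mdist mu -> exists nu, lifting S mu nu.
Proof.
move=> [mu01 mu1].
have [nu nuP] := choice lifting_unit_ex.
pose x (j : 'I_(size mu)) := tnth (in_tuple mu) j.
have -> : mu = \big[msetD/mset0]_(j < size mu)
    mdist_scale (x j).1 (mdist_unit (x j).2).
  rewrite {1}[LHS]mset_big1 big_tnth; apply: eq_bigr => j _.
  by rewrite mdist_scale_unit -surjective_pairing.
eexists; apply: (lifting_conv (fun j => nuP (x j).2)).
  by move=> j; apply: mu01; exact: mem_tnth.
by rewrite -[RHS]mu1 [RHS]big_tnth.
Qed.

Lemma lifting_sequence_ex mu0 : is_mdist mu0 ->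
  exists2 mu, lifting_sequence S mu & mu 0%N = mu0.
Proof.
move=> mu0P.
(* The conditional form makes [next] total; its iterates from [mu0] remain multi-distributions. *)
have /choice[next nextP] (mu : {mset (R * tm)%type}) :
    exists nu, is_mdist mu -> lifting S mu nu.
  case: (pselect (is_mdist mu)) => [/lifting_ex[nu ?]|?]; last by exists mu.
  by exists nu.
exists (fun n => iter n next mu0) => // n.
suff : is_mdist (iter n next mu0) by exact: nextP.
by elim: n => //= n /nextP/lifting_mdist[].
Qed.

Lemma lifting_sequence_mdist mu : lifting_sequence S mu -> is_mdist (mu 0%N).
Proof. by move=> /(_ 0%N)/lifting_mdist[]. Qed.

(** * Equivalence of strong and weak termination *)

Lemma fAST_wAST : fAST S <-> wAST S.
Proof.
split=> [fast t|wast mu muS].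
  have [mu muS mu0] := lifting_sequence_ex (mdist_unit_mdist R t).
  by exists mu; split=> //; exact: fast.
(* From [mdist_unit t] the mass after [n] steps is [nf_prob n t], so one terminating sequence
   determines the limit. *)
have Fcvg t : nf_prob n t @[n --> \oo] --> (1 : R).
  have [nu [nuS nu0]] := wast t; rewrite /almost_surely_terminating.
  by under eq_fun do rewrite nf_mass_sequence // nu0 expect_unit.
rewrite /almost_surely_terminating.
under eq_fun do rewrite nf_mass_sequence //.
(* The limit 1 becomes the total probability of [mu 0], so that convergence is checked summand by
   summand. *)
have [_ <-] := lifting_sequence_mdist muS.
apply: cvg_big => [|x _]; first exact: add_continuous.
by rewrite -[X in _ --> X]mulr1; apply: cvgMl_tmp.
Qed.

(** As [mu 0] has total probability 1, [1 - nf_mass] is a mean of [1 - nf_prob n]; nonnegativity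
    allows exchanging the series with the finite sum. *)
Lemma edlE mu : lifting_sequence S mu ->
  edl S mu = (\sum_(x <- mu 0%N)
    x.1%:E * \sum_(0 <= n <oo) (1 - nf_prob n x.2)%:E)%E.
Proof.
move=> muS; have [mu01 mu1] := lifting_sequence_mdist muS.
rewrite big_seq.
under eq_bigr => x _.
  rewrite -nneseriesZl; last by move=> n _; rewrite lee_fin subr_ge0 nf_prob_le1.
  over.
rewrite -nneseries_sum; last first.
  move=> x n /mu01/andP[x0 _].
  by rewrite mule_ge0 ?lee_fin ?subr_ge0 ?nf_prob_le1 // ltW.
apply: eq_eseriesr => n _; rewrite nf_mass_sequence // -{1}mu1 /expect -sumrB.
rewrite -big_seq -sumEFin; apply: eq_bigr => x _.
by rewrite -EFinM mulrBr mulr1.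
Qed.

Lemma fPAST_wPAST : fPAST S <-> wPAST S.
Proof.
split=> [fpast t|wpast mu muS].
  have [mu muS mu0] := lifting_sequence_ex (mdist_unit_mdist R t).
  by exists mu; split=> //; exact: fpast.
rewrite edlE //; elim/big_ind: _ => // [a b|x _]; first by rewrite fin_numD => -> ->.
(* The inner series at [x.2] is the [edl] of the sequence [nu] supplied by [wPAST], hence finite. *)
have [nu [nuS nu0]] := wpast x.2.
rewrite edlE // nu0 /mdist_unit enum_msetn big_seq1 mul1e.
exact: fin_numM.
Qed.

End Rewriting.

Theorem theorem4p5 (R : realType) (Sg : signature) (V : eqType)
    (S : ptrs R Sg V) :
  non_overlapping S -> linear_ptrs S -> non_erasing S ->
  (fAST S <-> wAST S) /\ (fPAST S <-> wPAST S).
Proof. by move=> NO LIN NE; split; [exact: fAST_wAST|exact: fPAST_wPAST]. Qed.
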